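(* Let $f:\mathbb{R}^n\to\mathbb{R}$ be a polynomial of degree three that is irreducible in $\mathbb{R}[x_1,\dots,x_n]$. Then the zero level set of $f$ is not an algebraic cmc hypersurface; that is, there do not exist a real constant $H\neq 0$ and a polynomial $p\in\mathbb{R}[x_1,\dots,x_n]$ such that the polynomial identity $$4(n-1)^2H^2\,|\nabla f|^6-\bigl(2\,|\nabla f|^2\,\Delta f-\nabla f^{t}\,\nabla |\nabla f|^2\bigr)^2=p\,f$$ holds on $\mathbb{R}^n$.
   Context: Here $\nabla f$ is the Euclidean gradient (as a column vector), $|\cdot|$ is the Euclidean norm, $\Delta f=\sum_{i=1}^n \partial^2 f/\partial x_i^2$ is the Laplacian, and $\nabla f^{t}\,\nabla|\nabla f|^2$ is the Euclidean inner product of $\nabla f$ with the gradient of the function $|\nabla f|^2$. An irreducible real polynomial $f$ in $n$ variables is said to define an algebraic cmc (constant mean curvature) hypersurface if there are a real constant $H\neq0$ and a real polynomial $p$ such that $4(n-1)^2H^2|\nabla f|^6-(2|\nabla f|^2\Delta f-\nabla f^{t}\nabla|\nabla f|^2)^2=pf$. The zero set $f^{-1}(0)$ is allowed to have singular points. *)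

(* Defs.v *)
From mathcomp Require Import all_boot all_order all_algebra.
From mathcomp Require Import reals.
From mathcomp Require Import mpoly.

Set Implicit Arguments.
Unset Strict Implicit.
Unset Printing Implicit Defensive.

Import GRing.Theory.
Local Open Scope ring_scope.

Definition irreducible_mpoly (R : idomainType) (n : nat)
    (f : {mpoly R[n]}) : Prop :=
  [/\ f != 0, f \isn't a GRing.unit
    & forall g h : {mpoly R[n]},
        f = g * h -> g \is a GRing.unit \/ h \is a GRing.unit].

Definition gradient (R : comNzRingType) (n : nat) (f : {mpoly R[n]}) :
    'cV[{mpoly R[n]}]_n :=
  \col_i f^`M(i).

Definition dotv (R : comNzRingType) (n : nat) (u v : 'cV[R]_n) : R :=
  (u^T *m v) 0 0.

Definition norm2_grad (R : comNzRingType) (n : nat) (f : {mpoly R[n]}) :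
    {mpoly R[n]} :=
  dotv (gradient f) (gradient f).

Definition laplacian (R : comNzRingType) (n : nat) (f : {mpoly R[n]}) :
    {mpoly R[n]} :=
  \sum_(i < n) f^`M(i)^`M(i).

(* R is infinite, so an identity of polynomial functions on R^n is an identity
   in {mpoly R[n]}; |grad f|^6 is the cube of the polynomial |grad f|^2. *)
Definition algebraic_cmc (R : realType) (n : nat) (f : {mpoly R[n]}) : Prop :=
  exists (H : R) (p : {mpoly R[n]}),
    H != 0 /\
    (4 * (n%:R - 1) ^+ 2 * H ^+ 2) *: norm2_grad f ^+ 3
      - (2 * norm2_grad f * laplacian f
         - dotv (gradient f) (gradient (norm2_grad f))) ^+ 2
    = p * f.

(* Main.v *)
From HB Require Import structures.
Require Import Defs.
From mathcomp Require Import all_boot all_order all_algebra.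
From mathcomp Require Import reals.
From mathcomp Require Import mpoly.
From mathcomp Require Import ring lra zify polyrcf.

(** Restricting the identity to the line spanned by [v] and comparing terms of
degree 12 shows that the cubic part [f3] of [f] is singular at each of its real
zeros. Hence, if [f3 w <> 0], the cubic [t |-> f3 (v + t w)] has a triple root
for every [v], and [f3] is a multiple of the cube of a linear form [l].

At the zeros of [f] the identity bounds the gradient by a constant times the
Hessian, which is O(1 + |l|). On a plane spanned by [w] and [u] with [l u = 0],
[f (x w + s u) = P x + s (al x + de) + s^2 ga] with [P] cubic. Solving
[f = 0] for [s] gives zeros with |x| arbitrarily large which violate this bound
unless [al = de = ga = 0]. So [f] is a univariate cubic in [l], which has a real
root and is therefore reducible. In dimension one the identity is void, but [f]
is trivially a univariate cubic. *)

Set Implicit Arguments.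
Unset Strict Implicit.
Unset Printing Implicit Defensive.

Import Order.TTheory GRing.Theory Num.Theory.
Local Open Scope ring_scope.

Local Notation ev f z := (f.@[fun i => (z : 'rV[_]_(_)) 0 i]).

(** * Growth of real cubics, and cubics in the plane *)

Lemma cubic_large_pos (R : realFieldType) (a b e k C B : R) : 0 < a ->
  exists x, B < x /\ C * (1 + x ^+ 2) < a * x ^+ 3 + b * x ^+ 2 + e * x + k.
Proof.
move=> a_gt0.
pose M := `|b| + `|e| + `|k| + 2 * `|C|.
have M_ge0 : 0 <= M by rewrite !addr_ge0 ?mulr_ge0 ?normr_ge0.
(* This gives [x >= 1] and [a * x >= M + a], so [a * x ^+ 3] exceeds [M * x ^+ 2], which absorbs all
   the other terms. *)
pose x := M / a + `|B| + 1.
have aM : a * (M / a) = M by rewrite mulrC divfK // gt_eqF.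
have MB : 0 <= M / a by rewrite divr_ge0 // ltW.
have B0 := normr_ge0 B; have B1 := ler_norm B.
exists x; split; first by rewrite /x; lra.
have x1 : 1 <= x by rewrite /x; lra.
have ax : M + a <= a * x by rewrite /x !mulrDr aM; nra.
have h3 : (M + a) * x ^+ 2 <= a * x ^+ 3.
  by rewrite (exprS x 2) (mulrA a) ler_wpM2r // exprn_ge0 //; lra.
have x2 : x <= x ^+ 2 by nra.
have lN y : - `|y| <= y :> R by rewrite lerNl -normrN ler_norm.
have hb := lN b; have he := lN e; have hk := lN k.
have hC := ler_norm C.
have C0 := normr_ge0 C; have b0 := normr_ge0 b.
have e0 := normr_ge0 e; have k0 := normr_ge0 k.
have tb : - `|b| * x ^+ 2 <= b * x ^+ 2 by rewrite ler_wpM2r //; nra.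
have te : - `|e| * x ^+ 2 <= e * x by nra.
have tk : - `|k| * x ^+ 2 <= k by nra.
have tC : C * (1 + x ^+ 2) <= 2 * `|C| * x ^+ 2 by nra.
have ax2 : 0 < a * x ^+ 2 by rewrite mulr_gt0 // exprn_gt0; lra.
by rewrite /M in h3; lra.
Qed.

Lemma cubic_large (R : realFieldType) (a b e k C B : R) : a != 0 ->
  exists x, B < `|x| /\ C * (1 + x ^+ 2) < a * x ^+ 3 + b * x ^+ 2 + e * x + k.
Proof.
case: ltgtP => // a0 _.
  have [|x [Bx Cx]] := @cubic_large_pos R (- a) b (- e) k C B; first by lra.
  exists (- x); split; first by rewrite normrN (lt_le_trans Bx) ?ler_norm.
  by move: Cx; rewrite sqrrN (exprS (- x)) sqrrN !(exprS x 2); lra.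
have [x [Bx Cx]] := @cubic_large_pos R a b e k C B a0.
by exists x; split => //; rewrite (lt_le_trans Bx) ?ler_norm.
Qed.

(** Solving the equation for [s] gives zeros along which one of the two partial derivatives outgrows
    a bound linear in |x|. The coefficients are eliminated in the order [ga], [al], [de]. *)
Lemma plane_cubic_degenerate (R : rcfType) (a b e k al de ga K : R) :
  a != 0 ->
  (forall x s, a * x ^+ 3 + b * x ^+ 2 + e * x + k
      + s * (al * x + de) + s ^+ 2 * ga = 0 ->
    `|3 * a * x ^+ 2 + 2 * b * x + e + s * al| <= K * (1 + `|x|) /\
    `|al * x + de + 2 * s * ga| <= K * (1 + `|x|)) ->
  [/\ al = 0, de = 0 & ga = 0].
Proof.
move=> a0 H.
have sqn (x : R) : (1 + `|x|) ^+ 2 <= 2 * (1 + x ^+ 2).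
  by rewrite -(real_normK (num_real x)); have := sqr_ge0 (1 - `|x|); nra.
have ga0 : ga = 0.
  apply/eqP/negP => /negP ga0.
  (* The equation is quadratic in [s] with discriminant [dl]; this [x] makes [dl] larger than
     [2 * K ^+ 2 * (1 + x ^+ 2)]. *)
  have [|x [_ Cx]] := @cubic_large R (- 4 * ga * a) (- 4 * ga * b)
    (- 4 * ga * e) (- 4 * ga * k) (2 * K ^+ 2) 0.
    by rewrite !mulf_neq0 // oppr_eq0 pnatr_eq0.
  set P := a * x ^+ 3 + b * x ^+ 2 + e * x + k.
  have Cx' : 2 * K ^+ 2 * (1 + x ^+ 2) < - 4 * ga * P by rewrite /P; lra.
  pose T := al * x + de; pose dl := T ^+ 2 - 4 * ga * P.
  have K0 : 0 <= 2 * K ^+ 2 * (1 + x ^+ 2).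
    by apply: mulr_ge0; [apply: mulr_ge0|apply: addr_ge0]; rewrite ?sqr_ge0.
  have T0 := sqr_ge0 T.
  have dl0 : 0 <= dl by rewrite /dl; lra.
  have r2 : Num.sqrt dl ^+ 2 = dl by rewrite sqr_sqrtr.
  (* At this root the derivative in [s] is the square root of [dl], so the hypothesis bounds [dl] by
     K^2 (1 + |x|)^2. *)
  pose s := (Num.sqrt dl - T) / (2 * ga).
  have sE : T + 2 * s * ga = Num.sqrt dl.
    by rewrite /s; field; rewrite ?ga0 ?pnatr_eq0.
  have [|_ h2] := H x s.
    have -> : a * x ^+ 3 + b * x ^+ 2 + e * x + k + s * (al * x + de)
        + s ^+ 2 * ga
      = P + ((T + 2 * s * ga) ^+ 2 - T ^+ 2) / (4 * ga).
      by rewrite /P /T; field; rewrite ?ga0 ?pnatr_eq0.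
    by rewrite sE r2 /dl; field; rewrite ?ga0 ?pnatr_eq0.
  rewrite -/T sE in h2.
  have h3 : dl <= (K * (1 + `|x|)) ^+ 2.
    by rewrite -r2 -(real_normK (num_real (Num.sqrt dl))) lerXn2r ?nnegrE //
      (le_trans _ h2).
  rewrite exprMn in h3; have := sqn x; have := sqr_ge0 K.
  by rewrite /dl in h3; nra.
subst ga.
(* The equation is now linear in [s]: its solution is put into the first bound, and the denominator
   [al * x + de] is cleared. *)
have H1 x : al * x + de != 0 ->
   `|(3 * a * x ^+ 2 + 2 * b * x + e) * (al * x + de)
     - al * (a * x ^+ 3 + b * x ^+ 2 + e * x + k)| <=
   K * (1 + `|x|) * `|al * x + de|.
  move=> T0; set P := a * x ^+ 3 + _ + _ + _.
  have [|h _] := H x (- P / (al * x + de)); first by rewrite -/P; field.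
  have -> : (3 * a * x ^+ 2 + 2 * b * x + e) * (al * x + de) - al * P =
    (3 * a * x ^+ 2 + 2 * b * x + e + - P / (al * x + de) * al) * (al * x + de).
    by field.
  by rewrite normrM ler_wpM2r.
have al0 : al = 0.
  apply/eqP/negP => /negP al0.
  (* These are the coefficients of the left-hand side of [H1], a true cubic, against a quadratic
     bound; |x| > |de / al| keeps [al * x + de] nonzero. *)
  have [|x [Bx Cx]] := @cubic_large R (2 * a * al)
      (3 * a * de + b * al) (2 * b * de) (e * de - al * k)
      (2 * `|K| * (`|al| + `|de|)) (`|de / al|).
    by rewrite !mulf_neq0 // pnatr_eq0.
  have T0 : al * x + de != 0.
    apply: contraTneq Bx => T0; rewrite -leNgt.
    have -> : x = - (de / al).
      by apply: (mulfI al0); rewrite mulrN mulrCA divff //; lra.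
    by rewrite normrN.
  have h := H1 x T0.
  have h' := le_trans (ler_norm _) h.
  have T1 : `|al * x + de| <= (`|al| + `|de|) * (1 + `|x|).
    apply: le_trans (ler_normD _ _) _; rewrite normrM.
    by have := normr_ge0 al; have := normr_ge0 de; have := normr_ge0 x; nra.
  have h2 : K * (1 + `|x|) * `|al * x + de|
      <= `|K| * (`|al| + `|de|) * (1 + `|x|) ^+ 2.
    rewrite expr2 -!mulrA mulrA [leRHS](_ : _ =
       (`|K| * (1 + `|x|)) * ((`|al| + `|de|) * (1 + `|x|))); last by ring.
    apply: le_trans (_ : `|K| * (1 + `|x|) * `|al * x + de| <= _).
      by rewrite !ler_wpM2r ?ler_norm ?addr_ge0.
    by rewrite ler_wpM2l // mulr_ge0 ?addr_ge0.
  have h3 : `|K| * (`|al| + `|de|) * (1 + `|x|) ^+ 2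
      <= `|K| * (`|al| + `|de|) * (2 * (1 + x ^+ 2)).
    by rewrite ler_wpM2l ?sqn // mulr_ge0 ?addr_ge0.
  by lra.
subst al; split => //; apply/eqP/negP => /negP de0.
(* [H1] now bounds a quadratic by a linear term; both are multiplied by [x] to reuse the growth of
   cubics. *)
have [|x [Bx Cx]] := @cubic_large R (3 * a) (2 * b) e 0 (2 * `|K|) 0.
  by rewrite mulf_neq0 // pnatr_eq0.
have := H1 x; rewrite !mul0r add0r subr0 => /(_ de0).
rewrite normrM ler_pM2r ?normr_gt0 // => h.
have h1 : x * (3 * a * x ^+ 2 + 2 * b * x + e) <= `|x| * (K * (1 + `|x|)).
  by apply: le_trans (ler_norm _) _; rewrite normrM ler_wpM2l.
have h2 : `|x| * (K * (1 + `|x|)) <= `|K| * (1 + `|x|) ^+ 2.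
  have := ler_norm K; have := normr_ge0 x; have := normr_ge0 K => ? ? ?.
  have : `|x| * (1 + `|x|) * K <= `|x| * (1 + `|x|) * `|K|.
    by rewrite ler_wpM2l // mulr_ge0 // addr_ge0.
  have : `|x| * (1 + `|x|) * `|K| <= (1 + `|x|) ^+ 2 * `|K|.
    by rewrite ler_wpM2r //; nra.
  by lra.
have := ler_wpM2l (normr_ge0 K) (sqn x); lra.
Qed.

(** * Directional derivatives and restriction to lines *)

Definition dderiv (R : comNzRingType) n (w : 'rV[R]_n) (g : {mpoly R[n]}) :=
  \sum_i w 0 i *: g^`M(i).

(** The univariate polynomial t |-> g (v + t w), obtained by substitution so as to be a ring
    morphism in [g]. *)
Definition line (R : comNzRingType) n (v w : 'rV[R]_n) (g : {mpoly R[n]}) :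
    {poly R} :=
  mmap (@polyC R) (fun i => (v 0 i)%:P + (w 0 i)%:P * 'X) g.

Section Line.
Variables (R : comNzRingType) (n : nat).
Implicit Types (f g : {mpoly R[n]}) (u v w z : 'rV[R]_n).

Lemma dderiv_is_linear w : linear (dderiv w).
Proof.
move=> c f g; rewrite /dderiv scaler_sumr -big_split /=.
by apply: eq_bigr => i _; rewrite mderivD mderivZ scalerDr !scalerA mulrC.
Qed.
HB.instance Definition _ w :=
  GRing.isLinear.Build R {mpoly R[n]} {mpoly R[n]} _ (dderiv w)
    (dderiv_is_linear w).

Lemma dderivDl c u v g : dderiv (c *: u + v) g = c *: dderiv u g + dderiv v g.
Proof.
rewrite /dderiv scaler_sumr -big_split /=.
by apply: eq_bigr => i _; rewrite !mxE scalerDl scalerA.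
Qed.

Lemma dderivC u v g : dderiv u (dderiv v g) = dderiv v (dderiv u g).
Proof.
rewrite /dderiv; under eq_bigr do rewrite (linear_sum (mderiv _)) scaler_sumr.
rewrite exchange_big /=; apply: eq_bigr => i _.
rewrite [in RHS](linear_sum (mderiv i)) [RHS]scaler_sumr; apply: eq_bigr => j _.
by rewrite /= !mderivZ !scalerA mulrC mderiv_comm.
Qed.

Lemma dderivM w f g : dderiv w (f * g) = dderiv w f * g + f * dderiv w g.
Proof.
rewrite /dderiv mulr_suml mulr_sumr -big_split /=; apply: eq_bigr => i _.
by rewrite mderivM scalerDr -scalerAl -scalerAr.
Qed.

Lemma dderivX w i : dderiv w 'X_i = (w 0 i)%:MP.
Proof.
rewrite /dderiv (bigD1 i) //= big1 ?addr0 => [|j ji].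
  have -> : 'X_i^`M(i) = 1 :> {mpoly R[n]}.
    rewrite mderivX mnm1E eqxx scale1r -mpolyX0; congr mpolyX.
    by apply/mnmP => j; rewrite mnmBE subnn mnm0E.
  by rewrite -alg_mpolyC.
by rewrite mderivX mnm1E eq_sym (negPf ji) scale0r scaler0.
Qed.

Lemma dderiv_delta i g : dderiv (delta_mx 0 i) g = g^`M(i).
Proof.
rewrite /dderiv (bigD1 i) //= big1 ?addr0 => [|j ji].
  by rewrite mxE !eqxx scale1r.
by rewrite mxE (negPf ji) andbF scale0r.
Qed.

HB.instance Definition _ v w := GRing.RMorphism.copy (@line R n v w)
  (mmap (@polyC R) (fun i => (v 0 i)%:P + (w 0 i)%:P * 'X)).

Lemma lineX v w i : line v w 'X_i = (v 0 i)%:P + (w 0 i)%:P * 'X.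
Proof. by rewrite /line mmapX mmap1U. Qed.

Lemma lineC v w c : line v w c%:MP = c%:P.
Proof. by rewrite /line mmapC. Qed.

Lemma lineZ v w c g : line v w (c *: g) = c *: line v w g.
Proof. by rewrite /line mmapZ mul_polyC. Qed.

(** The chain rule: by the Leibniz rule it passes from variables to monomials, and by linearity to
    [g]. *)
Lemma line_deriv v w g : (line v w g)^`() = line v w (dderiv w g).
Proof.
pose P f := (line v w f)^`() = line v w (dderiv w f).
have PM f h : P f -> P h -> P (f * h).
  by rewrite /P => Pf Ph; rewrite dderivM rmorphM rmorphD !rmorphM derivM Pf Ph.
have P1 : P 1.
  rewrite /P rmorph1 derivC /dderiv big1 ?rmorph0 // => i _.
  by rewrite -mpolyC1 mderivC scaler0.
have PX m : P 'X_[m].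
  rewrite mpolyXE_id; elim/big_ind: _ => // i _.
  elim: (m i) => [|k IH]; rewrite ?expr0 // exprS; apply: PM => //.
  rewrite /P lineX dderivX lineC.
  by rewrite derivD derivM !derivC derivX mul0r add0r mulr1 add0r.
change (P g); rewrite (mpolyE g); elim/big_ind: _.
- by rewrite /P !raddf0.
- by move=> f h Pf Ph; rewrite /P !raddfD; congr (_ + _).
by move=> m _; rewrite /P [dderiv w _]linearZ /= !lineZ derivZ PX.
Qed.

Lemma horner_line v w g t : (line v w g).[t] = ev g (v + t *: w).
Proof.
rewrite /line /mmap mevalE horner_sum; apply: eq_bigr => m _.
rewrite hornerM hornerC /mmap1 horner_prod; congr (_ * _).
apply: eq_bigr => i _.
by rewrite horner_exp !hornerE !mxE [w 0 i * t]mulrC.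
Qed.

Lemma size_line v w g : (size (line v w g) <= msize g)%N.
Proof.
rewrite /line /mmap msizeE; apply: leq_trans (size_sum _ _ _) _.
rewrite big_seq [X in (_ <= X)%N]big_seq.
elim/big_ind2: _ => // [a b c d ab cd|m _].
  by rewrite geq_max !leq_max ab cd orbT.
rewrite mul_polyC; apply: leq_trans (size_scale_leq _ _) _.
rewrite /mmap1 mdegE; elim/big_ind2: _ => [|p a q b pa qb|i _].
- by rewrite size_poly1.
- by apply: leq_trans (size_polyMleq _ _) _; lia.
apply: leq_trans (size_poly_exp_leq _ _) _; rewrite ltnS -[leqRHS]mul1n leq_mul2r.
apply/orP; right; rewrite -subn1 leq_subLR; apply: leq_trans (size_polyD _ _) _.
rewrite geq_max (leq_trans (size_polyC_leq1 _)) //= mul_polyC.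
by apply: leq_trans (size_scale_leq _ _) _; rewrite size_polyX.
Qed.

End Line.

(** * Total degree, derivatives and Taylor expansion *)

Lemma msize_leP (R : nzRingType) n (g : {mpoly R[n]}) k :
  (forall m, g@_m != 0 -> (mdeg m < k)%N) -> (msize g <= k)%N.
Proof.
move=> H; rewrite msizeE big_seq; apply/bigmax_leqP_seq => m _ mg.
by apply: H; rewrite -mcoeff_msupp.
Qed.

Section Degree.
Variables (R : numFieldType) (n : nat).
Implicit Types (f g : {mpoly R[n]}) (u v w z : 'rV[R]_n).

Lemma msize_mderiv i g k : (msize g <= k.+1)%N -> (msize g^`M(i) <= k)%N.
Proof.
move=> gk; apply: msize_leP => m; rewrite mcoeff_mderiv => h.
have : (m + U_(i))%MM \in msupp g.
  by rewrite mcoeff_msupp; apply: contraNneq h => ->; rewrite mul0rn.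
by move/msize_mdeg_lt; rewrite mdegD mdeg1 addn1; lia.
Qed.

Lemma msize_dderiv w g k : (msize g <= k.+1)%N -> (msize (dderiv w g) <= k)%N.
Proof.
move=> gk; apply: leq_trans (msize_sum _ _ _) _; apply/bigmax_leqP => i _.
by apply: leq_trans (msizeZ_le _ _) _; exact: msize_mderiv.
Qed.

(** A nonconstant monomial contains some variable, and in characteristic zero its coefficient
    survives differentiation in that variable. *)
Lemma msize_antideriv g k :
  (forall i, (msize g^`M(i) <= k)%N) -> (msize g <= k.+1)%N.
Proof.
move=> H; apply: msize_leP => m gm.
case: (eqVneq m 0%MM) => [->|m0]; first by rewrite mdeg0.
have [i mi] : exists i, (0 < m i)%N.
  apply/existsP; apply: contraNT m0; rewrite negb_exists => /forallP H0.
  by apply/eqP/mnmP => i; rewrite mnm0E; apply/eqP; rewrite -leqn0 leqNgt H0.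
have mE : m = (m - U_(i) + U_(i))%MM.
  apply/mnmP => j; rewrite mnmDE mnmBE mnm1E; case: eqP => [<-|_] /=; lia.
have : (m - U_(i))%MM \in msupp (g^`M(i)).
  by rewrite mcoeff_msupp mcoeff_mderiv -mE mulrn_eq0 /=.
move/msize_mdeg_lt => lt; rewrite mE mdegD mdeg1.
by have := H i; lia.
Qed.

Lemma coef0_line v w g : (line v w g)`_0 = ev g v.
Proof. by rewrite -horner_coef0 horner_line scale0r addr0. Qed.

Lemma coefS_line v w g k :
  (line v w g)`_k.+1 = (line v w (dderiv w g))`_k / k.+1%:R.
Proof.
by rewrite -line_deriv coef_deriv -[X in X / _]mulr_natr mulfK // pnatr_eq0.
Qed.

(** Induction on the degree: restrictions to lines parallel to the axes vanish at all natural
    numbers, hence are zero, so the partial derivatives vanish everywhere and [g] is constant. *)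
Lemma meval_eq0 g : (forall z, ev g z = 0) -> g = 0.
Proof.
move: {2}(msize g) (leqnn (msize g)) => k; elim: k g => [|k IH] g gk H.
  by apply/eqP; rewrite -msize_poly_eq0 -leqn0.
have H1 i : g^`M(i) = 0.
  apply: IH => [|z]; first exact: msize_mderiv.
  have l0 : line z (delta_mx 0 i) g = 0.
    apply/eqP/negP => /negP l0.
    have rt t : root (line z (delta_mx 0 i) g) t by rewrite /root horner_line H.
    have := @max_poly_roots _ _
      [seq k%:R | k <- iota 0 (size (line z (delta_mx 0 i) g))] l0.
    rewrite size_map size_iota ltnn => F; apply: notF; apply: F.
      by apply/allP => ? /mapP [? _ ->].
    by rewrite map_inj_uniq ?iota_uniq //; apply: mulrIn; rewrite oner_eq0.
  have := coefS_line z (delta_mx 0 i) g 0.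
  by rewrite l0 coef0 coef0_line dderiv_delta divr1.
have := @msize_antideriv g 0 => /(_ _) g1.
have : (msize g <= 1)%N by apply: g1 => i; rewrite H1 msize0.
move/msize1_polyC => gC; have := H 0; rewrite gC mevalC => ->.
by rewrite mpolyC0.
Qed.

Lemma meval_sum_coef_line g z k : (msize g <= k)%N ->
  ev g z = \sum_(i < k) (line 0 z g)`_i.
Proof.
move=> gk; have := horner_line 0 z g 1; rewrite add0r scale1r => <-.
rewrite (@horner_coef_wide _ k) ?(leq_trans (size_line _ _ _)) //.
by apply: eq_bigr => i _; rewrite expr1n mulr1.
Qed.

Lemma taylor_deg1 g z : (msize g <= 2)%N -> ev g z = ev g 0 + ev (dderiv z g) 0.
Proof.
move=> gk; rewrite (meval_sum_coef_line z gk).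
pose F i := (line 0 z g)`_i; rewrite -[LHS]/(\sum_(i < 2) F i).
rewrite !big_ord_recr big_ord0 /= add0r /F coefS_line !coef0_line.
by rewrite divr1.
Qed.

Lemma taylor_deg2 g z : (msize g <= 3)%N ->
  ev g z = ev g 0 + ev (dderiv z g) 0 + ev (dderiv z (dderiv z g)) 0 / 2.
Proof.
move=> gk; rewrite (meval_sum_coef_line z gk).
pose F i := (line 0 z g)`_i; rewrite -[LHS]/(\sum_(i < 3) F i).
rewrite !big_ord_recr big_ord0 /= add0r /F.
by rewrite !coefS_line !coef0_line !divr1.
Qed.

Lemma taylor_deg3 g z : (msize g <= 4)%N ->
  ev g z = ev g 0 + ev (dderiv z g) 0 + ev (dderiv z (dderiv z g)) 0 / 2
    + ev (dderiv z (dderiv z (dderiv z g))) 0 / 6.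
Proof.
move=> gk; rewrite (meval_sum_coef_line z gk).
pose F i := (line 0 z g)`_i; rewrite -[LHS]/(\sum_(i < 4) F i).
rewrite !big_ord_recr big_ord0 /= add0r /F.
rewrite !coefS_line !coef0_line; congr (_ + _ + _ + _); rewrite !divr1 //.
by rewrite -mulrA -invfM -natrM.
Qed.
End Degree.

(** * Reducibility of cubics in one linear form *)

Lemma mpoly_unitC (R : idomainType) n (g : {mpoly R[n]}) :
  g \is a GRing.unit -> g = (g@_0%MM)%:MP.
Proof. by case/andP => /eqP. Qed.

(** Along the line spanned by [w], [f] is a univariate cubic with a root [r]; if [L] is the linear
    form with coefficients [c], then [L - r] divides [f]. *)
Lemma one_variable_reducible (R : rcfType) n (f : {mpoly R[n]})
    (w : 'rV[R]_n) (c : 'I_n -> R) :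
  msize f = 4%N -> \sum_i w 0 i * c i = 1 ->
  ev (dderiv w (dderiv w (dderiv w f))) 0 != 0 ->
  (forall z : 'rV[R]_n, ev f z = ev f ((\sum_i z 0 i * c i) *: w)) ->
  ~ irreducible_mpoly f.
Proof.
move=> f4 lw Cw fl [_ _ irr].
pose P := line 0 w f.
have P4 : size P = 4%N.
  apply/eqP; rewrite eqn_leq (leq_trans (size_line _ _ _)) ?f4 //=.
  rewrite ltnNge; apply/negP => /leq_sizeP/(_ 3%N (leqnn _)).
  rewrite !coefS_line coef0_line => /eqP; rewrite !mulf_eq0 (negPf Cw) /=.
  by rewrite !invr_eq0 !pnatr_eq0.
have [r] : {x | root P x} by apply: odd_poly_root; rewrite P4.
case/factor_theorem => Q PQ.
pose L : {mpoly R[n]} := \sum_i c i *: 'X_i.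
have lE (z : 'rV[R]_n) : ev L z = \sum_i z 0 i * c i.
  rewrite /L raddf_sum; apply: eq_bigr => i _.
  by rewrite /= mevalZ mevalXU mulrC.
pose q : {mpoly R[n]} := \sum_(i < size Q) Q`_i *: L ^+ i.
have fE : f = q * (L - r%:MP).
  apply/eqP; rewrite -subr_eq0; apply/eqP/meval_eq0 => z.
  rewrite mevalB mevalM mevalB mevalC lE fl.
  have := horner_line 0 w f (\sum_i z 0 i * c i); rewrite add0r => <-.
  rewrite -/P PQ.
  rewrite hornerM !hornerE; apply/eqP; rewrite subr_eq0; apply/eqP; congr (_ * _).
  rewrite horner_coef /q raddf_sum; apply: eq_bigr => i _.
  by rewrite /= mevalZ rmorphXn /= lE.
have L2 : (msize L <= 2)%N.
  apply: leq_trans (msize_sum _ _ _) _; apply/bigmax_leqP => i _.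
  by apply: leq_trans (msizeZ_le _ _) _; rewrite msizeX mdeg1.
(* A constant [q] would leave [f] of degree at most one; a constant [L - r] would give [L] equal
   values at [w] and 0, that is 1 = 0. *)
have := irr _ _ fE; case => /mpoly_unitC.
  move=> qC; move: f4; rewrite fE qC mul_mpolyC => f4.
  have := msizeZ_le (L - r%:MP) (q@_0%MM); rewrite f4.
  have := msizeD_le L (- r%:MP); rewrite msizeN msizeC.
  by case: (r != 0) => /=; lia.
move=> LC; have := lE w; have := lE 0.
have -> : L = (L - r%:MP) + r%:MP by rewrite subrK.
rewrite LC !mevalD !mevalC lw => ->; rewrite big1 => [/eqP|i _].
  by rewrite eq_sym oner_eq0.
by rewrite mxE mul0r.
Qed.

(** * Symmetric trilinear forms whose cubic is singular at its zeros *)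

Lemma cubic_root (R : rcfType) (a b e k : R) : a != 0 ->
  exists x, a * x ^+ 3 + b * x ^+ 2 + e * x + k = 0.
Proof.
move=> a0; pose p := Poly [:: k; e; b; a].
have [x] : {x | root p x}.
  by apply: odd_poly_root; rewrite /p (@PolyK _ 0) //=.
rewrite /root /p horner_Poly /= => /eqP px; exists x; rewrite -[RHS]px.
by ring.
Qed.

Lemma linear_formZ (R : nzRingType) (V : lmodType R) (L : V -> R) :
  (forall c u v, L (c *: u + v) = c * L u + L v) ->
  forall c u, L (c *: u) = c * L u.
Proof.
move=> lin c u; rewrite -[_ *: _]addr0 lin.
have -> : L 0 = 0; last by rewrite addr0.
by have := lin (-1) 0 0; rewrite scaler0 add0r mulN1r addNr.
Qed.

Section TrilinearForm.
Variables (R : rcfType) (V : lmodType R) (C : V -> V -> V -> R).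
Hypothesis C_linear : forall c u u' v z,
  C (c *: u + u') v z = c * C u v z + C u' v z.
Hypothesis C_sym12 : forall u v z, C u v z = C v u z.
Hypothesis C_sym23 : forall u v z, C u v z = C u z v.
Hypothesis C_singular : forall v u, C v v v = 0 -> C u v v = 0.
Let C_linear2 c u u' v z : C v (c *: u + u') z = c * C v u z + C v u' z.
Proof. by rewrite C_sym12 C_linear !(C_sym12 v). Qed.

Let C_linear3 c u u' v z : C v z (c *: u + u') = c * C v z u + C v z u'.
Proof. by rewrite C_sym23 C_linear2 !(C_sym23 v z). Qed.

(** Polarisation: if [b] and [c] have zero cubes, singularity reduces [C a (b + c) (b + c)] to
    [2 * C a b c], so the cube of [b + c] is nonzero. *)
Lemma trilinear_cube_neq0 a b c : C a b c != 0 -> exists w, C w w w != 0.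
Proof.
move=> h.
have [bb|] := eqVneq (C b b b) 0; last by exists b.
have [cc|] := eqVneq (C c c c) 0; last by exists c.
exists (1 *: b + c); apply: contraNneq h => /(C_singular a).
rewrite !(C_linear2, C_linear3) (C_singular _ bb) (C_singular _ cc).
by rewrite (C_sym23 a c b) => ?; apply/eqP; lra.
Qed.

Variable w : V.
Hypothesis Cw : C w w w != 0.

(* With C u w w = 0 the real root t0 of t |-> C(u+tw)^3 is a double root by
   singularity, and so is -2 t0; hence t0 = 0. *)
Lemma trilinear_cube_eq0 u : C u w w = 0 -> C u u u = 0.
Proof.
move=> uww.
have wuw : C w u w = 0 by rewrite C_sym12.
have wwu : C w w u = 0 by rewrite C_sym23.
have uwu : C u w u = C w u u by rewrite C_sym12.
have uuw : C u u w = C w u u by rewrite C_sym23 C_sym12.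
have E3 t : C (t *: w + u) (t *: w + u) (t *: w + u)
    = C w w w * t ^+ 3 + 0 * t ^+ 2 + 3 * C w u u * t + C u u u.
  rewrite !(C_linear, C_linear2, C_linear3) uww wuw wwu uwu uuw; ring.
have E2 t : C w (t *: w + u) (t *: w + u) = C w w w * t ^+ 2 + C w u u.
  rewrite !(C_linear2, C_linear3) wuw wwu; ring.
have [t Et] := cubic_root 0 (3 * C w u u) (C u u u) Cw.
have Z1 : C w w w * t ^+ 2 + C w u u = 0.
  by rewrite -E2; apply: C_singular; rewrite E3.
have Z2 : C w w w * (- 2 * t) ^+ 2 + C w u u = 0.
  rewrite -E2; apply: C_singular; rewrite E3.
  have -> : C w u u = - (C w w w * t ^+ 2) by lra.
  have -> : C u u u = - (C w w w * t ^+ 3 + 3 * C w u u * t) by lra.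
  have -> : C w u u = - (C w w w * t ^+ 2) by lra.
  by ring.
have /eqP : C w w w * t ^+ 2 = 0.
  by move: Z2; rewrite exprMn; lra.
rewrite mulf_eq0 (negPf Cw) /= expf_eq0 /= => /eqP t0.
by move: Et; rewrite t0; lra.
Qed.

(** On the kernel of [C _ w w] the cube vanishes; singularity and polarisation then kill [C] as soon
    as two arguments lie in it. Splitting [p] and [q] along [w] and this kernel leaves only a
    multiple of [C u w w]. *)
Lemma trilinear_ker_eq0 u p q : C u w w = 0 -> C u p q = 0.
Proof.
move=> uw.
have K2 v x : C v w w = 0 -> C v v x = 0.
  move=> vw; rewrite C_sym23 C_sym12; apply: C_singular.
  exact: trilinear_cube_eq0.
have K3 v v' x : C v w w = 0 -> C v' w w = 0 -> C v v' x = 0.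
  move=> vw v'w; have := K2 (1 *: v + v') x.
  rewrite !(C_linear, C_linear2) vw v'w => /(_ _).
  rewrite !K2 // (C_sym12 v' v); lra.
have dec x : exists c, exists2 x', C x' w w = 0 & x = c *: w + x'.
  exists (C x w w / C w w w), (x - (C x w w / C w w w) *: w);
    last by rewrite addrC subrK.
  by rewrite addrC -scaleNr C_linear mulNr divfK // addNr.
have [c [p' p'w ->]] := dec p; have [d [q' q'w ->]] := dec q.
rewrite !(C_linear2, C_linear3) uw (C_sym23 u w q').
by rewrite !(K3 u p') // (K3 u q') //; ring.
Qed.

End TrilinearForm.

(** * Cubic functions and directions invisible to their cubic part *)

Section CubicFunction.
Variables (R : rcfType) (V : lmodType R) (D0 : R) (D1 : V -> R).
Variables (D2 : V -> V -> R) (D3 : V -> V -> V -> R).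
Hypothesis D1l : forall c u v, D1 (c *: u + v) = c * D1 u + D1 v.
Hypothesis D2l : forall c u v z, D2 (c *: u + v) z = c * D2 u z + D2 v z.
Hypothesis D2C : forall u v, D2 u v = D2 v u.
Hypothesis D3l : forall c u u' v z,
  D3 (c *: u + u') v z = c * D3 u v z + D3 u' v z.
Hypothesis D3_12 : forall u v z, D3 u v z = D3 v u z.
Hypothesis D3_23 : forall u v z, D3 u v z = D3 u z v.

(** [F] is a cubic given by its Taylor expansion at 0, and [dF v] is its derivative along [v]. *)
Let F z := D0 + D1 z + D2 z z / 2 + D3 z z z / 6.
Let dF v z := D1 v + D2 z v + D3 z z v / 2.

Let D2r c u u' v : D2 v (c *: u + u') = c * D2 v u + D2 v u'.
Proof. by rewrite D2C D2l !(D2C v). Qed.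

Let D3m c u u' v z : D3 v (c *: u + u') z = c * D3 v u z + D3 v u' z.
Proof. by rewrite D3_12 D3l !(D3_12 v). Qed.

Let D3r c u u' v z : D3 v z (c *: u + u') = c * D3 v z u + D3 v z u'.
Proof. by rewrite D3_23 D3m !(D3_23 v z). Qed.

(** Third-order terms involving [u] drop out, so [F (y *: w + s *: u)] has the shape treated in
    [plane_cubic_degenerate], which removes every term in [s]. *)
Lemma cubic_function_ker_invariant (w u : V) (K : R) :
  D3 w w w != 0 -> (forall a b, D3 u a b = 0) ->
  (forall y s, F (y *: w + s *: u) = 0 ->
    `|dF w (y *: w + s *: u)| <= K * (1 + `|y|) /\
    `|dF u (y *: w + s *: u)| <= K * (1 + `|y|)) ->
  forall x, F (x *: w + u) = F (x *: w).
Proof.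
move=> Dw Ku H x.
have Ku2 a b : D3 a u b = 0 by rewrite D3_12.
have Ku3 a b : D3 a b u = 0 by rewrite D3_23.
have D1Z := linear_formZ D1l.
have D2Z v := linear_formZ (fun c a b => D2l c a b v).
have D2Zr v := linear_formZ (fun c a b => D2r c a b v).
have D3Z v z := linear_formZ (fun c a b => D3l c a b v z).
have D3Zm v z := linear_formZ (fun c a b => D3m c a b v z).
have D3Zr v z := linear_formZ (fun c a b => D3r c a b v z).
have DE := (D1l, D1Z, D2l, D2r, D2Z, D2Zr, D3l, D3m, D3r, D3Z, D3Zm, D3Zr).
have [||al de ga] := @plane_cubic_degenerate R (D3 w w w / 6) (D2 w w / 2)
    (D1 w) D0 (D2 w u) (D1 u) (D2 u u / 2) K.
- by rewrite mulf_neq0 // invr_eq0 pnatr_eq0.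
- move=> y s Fz; have [|Hw Hu] := H y s.
    by rewrite -[RHS]Fz /F !DE !(Ku, Ku2, Ku3) (D2C u w); field.
  split; [apply: le_trans Hw|apply: le_trans Hu]; rewrite le_eqVlt; apply/orP;
    left; apply/eqP; congr `|_|; rewrite /dF !DE !(Ku, Ku2, Ku3) ?(D2C u w);
    by field.
have {}ga : D2 u u = 0 by lra.
by rewrite /F !DE !(Ku, Ku2, Ku3) (D2C u w) al de ga; field.
Qed.

End CubicFunction.

(** * The terms of the cmc identity: degrees and estimates *)

Lemma dotvE (R : comNzRingType) n (u v : 'cV[R]_n) :
  dotv u v = \sum_i u i 0 * v i 0.
Proof. by rewrite /dotv mxE; apply: eq_bigr => i _; rewrite mxE. Qed.

Lemma norm2_gradE (R : comNzRingType) n (f : {mpoly R[n]}) :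
  norm2_grad f = \sum_i f^`M(i) ^+ 2.
Proof.
by rewrite /norm2_grad dotvE; apply: eq_bigr => i _; rewrite !mxE expr2.
Qed.

Lemma mderiv_norm2_grad (R : comNzRingType) n (f : {mpoly R[n]}) i :
  (norm2_grad f)^`M(i) = 2 * \sum_j f^`M(j) * f^`M(j)^`M(i).
Proof.
rewrite norm2_gradE (linear_sum (mderiv i)) mulr_sumr; apply: eq_bigr => j _.
by rewrite /= expr2 mderivM; ring.
Qed.

Lemma msizeM_leq (R : idomainType) n (p q : {mpoly R[n]}) a b :
  (msize p <= a.+1)%N -> (msize q <= b.+1)%N -> (msize (p * q) <= (a + b).+1)%N.
Proof.
have [->|p0] := eqVneq p 0; first by rewrite mul0r msize0.
have [->|q0] := eqVneq q 0; first by rewrite mulr0 msize0.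
by rewrite msizeM //; lia.
Qed.

Lemma msize_sum_leq (R : nzRingType) n (I : finType) (F : I -> {mpoly R[n]}) k :
  (forall i, (msize (F i) <= k)%N) -> (msize (\sum_i F i) <= k)%N.
Proof.
by move=> Fk; apply: leq_trans (msize_sum _ _ _) _; apply/bigmax_leqP => i _.
Qed.

Lemma msizeB_leq (R : nzRingType) n (p q : {mpoly R[n]}) k :
  (msize p <= k)%N -> (msize q <= k)%N -> (msize (p - q) <= k)%N.
Proof.
by move=> pk qk; apply: leq_trans (msizeD_le _ _) _; rewrite msizeN geq_max pk.
Qed.

(** Where the gradient is nonzero, this is 2 |grad f|^3 times the divergence of the unit normal grad
    f / |grad f|. *)
Definition cmc_numerator (R : comNzRingType) n (f : {mpoly R[n]}) :=
  2 * norm2_grad f * laplacian f - dotv (gradient f) (gradient (norm2_grad f)).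

Section CubicDegrees.
Variables (R : realFieldType) (n : nat) (f : {mpoly R[n]}).
Hypothesis f4 : msize f = 4%N.

Lemma cubic_msize_grad i : (msize f^`M(i) <= 3)%N.
Proof. by apply: msize_mderiv; rewrite f4. Qed.

Lemma cubic_msize_norm2_grad : (msize (norm2_grad f) <= 5)%N.
Proof.
rewrite norm2_gradE; apply: msize_sum_leq => i.
by rewrite expr2; apply: (@msizeM_leq _ _ _ _ 2 2); exact: cubic_msize_grad.
Qed.

Lemma cubic_msize_cmc_numerator : (msize (cmc_numerator f) <= 6)%N.
Proof.
apply: msizeB_leq; last first.
  rewrite dotvE; apply: msize_sum_leq => i; rewrite !mxE.
  apply: (@msizeM_leq _ _ _ _ 2 3); first exact: cubic_msize_grad.
  exact/msize_mderiv/cubic_msize_norm2_grad.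
apply: (@msizeM_leq _ _ _ _ 4 1).
  rewrite -mpolyC_nat mul_mpolyC; apply: leq_trans (msizeZ_le _ _) _.
  exact: cubic_msize_norm2_grad.
by apply: msize_sum_leq => i; exact/msize_mderiv/cubic_msize_grad.
Qed.

(** Along t |-> t v, [f] has degree at most 2, so [p * f] and hence |grad f|^6 have degree at most
    11. The latter degree is three times that of |grad f|^2, which is therefore at most 3, and the
    t^4 coefficient of |grad f|^2 vanishes. *)
Lemma cubic_part_singular (c : R) (p : {mpoly R[n]}) (v : 'rV[R]_n) : c != 0 ->
  c *: norm2_grad f ^+ 3 - cmc_numerator f ^+ 2 = p * f ->
  ev (dderiv v (dderiv v (dderiv v f))) 0 = 0 ->
  forall i, ev (dderiv v (dderiv v f^`M(i))) 0 = 0.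
Proof.
move=> c0 eqf fv i.
have f0 : f != 0 by rewrite -msize_poly_eq0 f4.
have N5 := cubic_msize_norm2_grad; have L6 := cubic_msize_cmc_numerator.
have L11 : (msize (cmc_numerator f ^+ 2) <= 11)%N.
  by rewrite expr2; apply: (@msizeM_leq _ _ _ _ 5 5).
have N13 : (msize (norm2_grad f ^+ 3) <= 13)%N.
  rewrite exprS; apply: (@msizeM_leq _ _ _ _ 4 8) => //.
  by rewrite expr2; apply: (@msizeM_leq _ _ _ _ 4 4).
have p10 : (msize p <= 10)%N.
  have [->|p0] := eqVneq p 0; first by rewrite msize0.
  have : (msize (p * f) <= 13)%N.
    rewrite -eqf; apply: msizeB_leq; last exact: leq_trans L11 _.
    exact: leq_trans (msizeZ_le _ _) _.
  by rewrite msizeM // f4 addnS /= => ?; rewrite -(leq_add2r 3).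
pose phi := @line R n 0 v.
have sf : (size (phi f) <= 3)%N.
  apply/leq_sizeP => j; rewrite leq_eqVlt => /predU1P [<-|j4].
    by rewrite /phi !coefS_line coef0_line fv !mul0r.
  by apply: (leq_sizeP _ 4%N) => //; rewrite -f4 size_line.
have spf : (size (phi (p * f)%R) <= 12)%N.
  rewrite /phi rmorphM; apply: leq_trans (size_polyMleq _ _) _.
  rewrite -subn1 leq_subLR; apply: (@leq_add _ _ 10 3) => //.
  exact: leq_trans (size_line _ _ _) p10.
have sN3 : (size (phi (norm2_grad f) ^+ 3) <= 12)%N.
  rewrite -[_ ^+ 3](scalerK c0) -rmorphXn /= -lineZ.
  apply: leq_trans (size_scale_leq _ _) _.
  have -> : c *: norm2_grad f ^+ 3 = p * f + cmc_numerator f ^+ 2.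
    by rewrite -eqf subrK.
  rewrite rmorphD; apply: leq_trans (size_polyD _ _) _.
  by rewrite geq_max spf (leq_trans (size_line _ _ _)) // (leq_trans L11).
have sN : (size (phi (norm2_grad f)) <= 4)%N.
  have : ((size (phi (norm2_grad f))).-1 * 3 <= 11)%N.
    by rewrite -size_exp -subn1 leq_subLR.
  by move: (size _) => k; lia.
have : (phi (norm2_grad f))`_4 = 0 by apply: (leq_sizeP _ _ sN).
have sfi j : (size (phi (f^`M(j))) <= 3)%N.
  by apply: leq_trans (size_line _ _ _) _; exact: cubic_msize_grad.
rewrite norm2_gradE /phi rmorph_sum /= coef_sum.
(* Each partial derivative has degree at most 2 on the line, so t^4 collects a sum of squares, all
   of which must vanish. *)
have -> : \sum_j (line 0 v (f^`M(j) ^+ 2))`_4 = \sum_j (phi f^`M(j))`_2 ^+ 2.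
  apply: eq_bigr => j _; rewrite expr2 rmorphM /= coefM -/phi.
  rewrite !big_ord_recr big_ord0 /=.
  have z3 := leq_sizeP _ _ (sfi j) 3%N isT; have z4 := leq_sizeP _ _ (sfi j) 4%N isT.
  by rewrite /subn /= z3 z4; ring.
move/eqP; rewrite psumr_eq0 => [/allP /(_ i)|j _]; last exact: sqr_ge0.
rewrite mem_index_enum => /(_ isT) /=; rewrite sqrf_eq0 /phi !coefS_line coef0_line.
by rewrite !mulf_eq0 !invr_eq0 !pnatr_eq0 !orbF => /eqP.
Qed.

End CubicDegrees.

(** [g] and [h] stand for the gradient and Hessian at a zero of [f]. With N = |g|^2 the squared term
    is at most (4 n M N)^2, and dividing by N^2 gives r^2 N <= (4 n M)^2. *)
Lemma gradient_le_hessian (R : realFieldType) n (g : 'I_n -> R)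
    (h : 'I_n -> 'I_n -> R) (r M : R) : r != 0 ->
  (forall i j, `|h i j| <= M) ->
  r ^+ 2 * (\sum_i g i ^+ 2) ^+ 3 =
   (2 * (\sum_i g i ^+ 2) * (\sum_i h i i)
     - \sum_i g i * (2 * \sum_j g j * h j i)) ^+ 2 ->
  forall i, `|g i| <= 4 * n%:R / `|r| * M.
Proof.
move=> r0 hM; set N := \sum_i _ ^+ 2; set L := (X in _ = X ^+ 2 -> _) => eqL i.
have M0 : 0 <= M by apply: le_trans (hM i i).
have gN j : g j ^+ 2 <= N.
  by rewrite /N (bigD1 j) //= lerDl sumr_ge0 // => k _; exact: sqr_ge0.
have N0 : 0 <= N by apply: le_trans (gN i); exact: sqr_ge0.
have LN : `|L| <= 4 * n%:R * M * N.
  apply: le_trans (ler_normB _ _) _.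
  have h1 : `|2 * N * (\sum_i h i i)| <= 2 * N * (n%:R * M).
    rewrite normrM ger0_norm ?mulr_ge0 // ler_wpM2l ?mulr_ge0 //.
    apply: le_trans (ler_norm_sum _ _ _) _.
    rewrite mulr_natl -[in leRHS](card_ord n) -sumr_const; exact: ler_sum.
  have h2 : `|\sum_i g i * (2 * \sum_j g j * h j i)| <= 2 * N * (n%:R * M).
    apply: le_trans (ler_norm_sum _ _ _) _.
    (* From 2 |g a| |g b| <= g a ^+ 2 + g b ^+ 2; this double sum equals 2 n M N. *)
    apply: (@le_trans _ _ (\sum_i \sum_j (g i ^+ 2 + g j ^+ 2) * M)).
      apply: ler_sum => a _; rewrite !normrM normr_nat mulrCA.
      apply: (@le_trans _ _ (2 * (`|g a| * \sum_j `|g j * h j a|))).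
        rewrite ler_wpM2l // ler_wpM2l //; exact: ler_norm_sum.
      rewrite !mulr_sumr; apply: ler_sum => b _; rewrite normrM.
      have hh := hM b a; have A0 := normr_ge0 (g a); have B0 := normr_ge0 (g b).
      have AB := sqr_ge0 (`|g a| - `|g b|).
      rewrite -(real_normK (num_real (g a))) -(real_normK (num_real (g b))).
      apply: (@le_trans _ _ (2 * (`|g a| * (`|g b| * M)))).
        by rewrite !ler_wpM2l.
      have : 2 * `|g a| * `|g b| <= `|g a| ^+ 2 + `|g b| ^+ 2 by nra.
      by move/(ler_wpM2r M0); lra.
    under eq_bigr do rewrite -mulr_suml big_split /= sumr_const card_ord.
    rewrite -mulr_suml big_split /= sumr_const card_ord -/N sumrMnl -/N.
    by rewrite -mulr_natr; lra.
  lra.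
have [N00|N00] := eqVneq N 0.
  have : g i ^+ 2 <= 0 by rewrite -N00.
  rewrite le_eqVlt ltNge sqr_ge0 orbF sqrf_eq0 => /eqP ->.
  by rewrite normr0 !mulr_ge0 ?invr_ge0.
have Np : 0 < N by rewrite lt_def N00.
have rp : 0 < `|r| by rewrite normr_gt0.
have rN : (`|r| * `|g i|) ^+ 2 <= (4 * n%:R * M) ^+ 2.
  have : `|r| ^+ 2 * N <= (4 * n%:R * M) ^+ 2.
    rewrite -(ler_pM2r (exprn_gt0 2 Np)) -exprMn.
    apply: (@le_trans _ _ (`|L| ^+ 2)).
      by rewrite !real_normK ?num_real // -eqL -mulrA -exprS.
    by rewrite lerXn2r ?nnegrE ?mulr_ge0.
  apply: le_trans; rewrite exprMn ler_wpM2l ?sqr_ge0 //.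
  by rewrite real_normK ?num_real.
rewrite ler_sqr ?nnegrE ?mulr_ge0 // in rN.
by rewrite mulrAC ler_pdivlMr // mulrC.
Qed.

(** * Third derivatives and Taylor jets at the origin *)

Lemma cubic_third_derivative_neq0 (R : numFieldType) n (f : {mpoly R[n]}) :
  msize f = 4%N ->
  exists i j k, ev (f^`M(i)^`M(j)^`M(k)) 0 != 0.
Proof.
move=> f4.
have [/existsP [i /existsP [j /existsP [k h]]]|] := boolP [exists i, exists j,
  exists k, ev (f^`M(i)^`M(j)^`M(k)) 0 != 0]; first by exists i, j, k.
rewrite negb_exists => /forallP H.
(* The third partial derivatives are constants, so vanishing at 0 makes them zero and the degree of
   [f] at most two. *)
suff : (msize f <= 3)%N by rewrite f4.
apply: msize_antideriv => i; apply: msize_antideriv => j.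
apply: msize_antideriv => k; rewrite leqn0 msize_poly_eq0.
have := H i; rewrite negb_exists => /forallP /(_ j).
rewrite negb_exists => /forallP /(_ k); rewrite negbK.
have : (msize (f^`M(i)^`M(j)^`M(k)) <= 1)%N.
  by do 3!apply: msize_mderiv; rewrite f4.
by move/msize1_polyC => ->; rewrite mevalC mpolyC_eq0.
Qed.

(** Derivatives at 0 as multilinear forms in the directions; for a cubic, [jet3 f v v v] is six
    times the cubic part at [v]. *)
Definition jet1 (R : comNzRingType) n (f : {mpoly R[n]}) u : R :=
  ev (dderiv u f) 0.
Definition jet2 (R : comNzRingType) n (f : {mpoly R[n]}) u v : R :=
  ev (dderiv u (dderiv v f)) 0.
Definition jet3 (R : comNzRingType) n (f : {mpoly R[n]}) u v z : R :=
  ev (dderiv u (dderiv v (dderiv z f))) 0.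

Section Jets.
Variables (R : numFieldType) (n : nat) (f : {mpoly R[n]}).

Lemma meval_dderivE (u : 'rV[R]_n) (g : {mpoly R[n]}) z :
  ev (dderiv u g) z = \sum_i u 0 i * ev (g^`M(i)) z.
Proof.
by rewrite /dderiv raddf_sum; apply: eq_bigr => i _; rewrite /= mevalZ.
Qed.

Lemma meval_dderivDl c (u v : 'rV[R]_n) (g : {mpoly R[n]}) z :
  ev (dderiv (c *: u + v) g) z = c * ev (dderiv u g) z + ev (dderiv v g) z.
Proof. by rewrite dderivDl mevalD mevalZ. Qed.

Lemma jet1_linear c u v : jet1 f (c *: u + v) = c * jet1 f u + jet1 f v.
Proof. exact: meval_dderivDl. Qed.

Lemma jet2_linear c u v z :
  jet2 f (c *: u + v) z = c * jet2 f u z + jet2 f v z.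
Proof. exact: meval_dderivDl. Qed.

Lemma jet2C u v : jet2 f u v = jet2 f v u.
Proof. by rewrite /jet2 dderivC. Qed.

Lemma jet3_linear c u u' v z :
  jet3 f (c *: u + u') v z = c * jet3 f u v z + jet3 f u' v z.
Proof. exact: meval_dderivDl. Qed.

Lemma jet3_sym12 u v z : jet3 f u v z = jet3 f v u z.
Proof. by rewrite /jet3 dderivC. Qed.

Lemma jet3_sym23 u v z : jet3 f u v z = jet3 f u z v.
Proof. by rewrite /jet3 (dderivC v). Qed.

Hypothesis f4 : msize f = 4%N.

Lemma cubic_jetE z :
  ev f z = ev f 0 + jet1 f z + jet2 f z z / 2 + jet3 f z z z / 6.
Proof. by apply: taylor_deg3; rewrite f4. Qed.

Lemma cubic_dderiv_jetE w z :
  ev (dderiv w f) z = jet1 f w + jet2 f z w + jet3 f z z w / 2.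
Proof. by apply: taylor_deg2; apply: msize_dderiv; rewrite f4. Qed.

Lemma cubic_dderiv2_jetE u w z :
  ev (dderiv u (dderiv w f)) z = jet2 f u w + jet3 f z u w.
Proof. by apply: taylor_deg1; do 2!apply: msize_dderiv; rewrite f4. Qed.

End Jets.

(** * Cubics satisfying the cmc identity *)

Section CmcCubic.
Variables (R : rcfType) (n : nat) (f : {mpoly R[n]}) (r : R) (p : {mpoly R[n]}).
Hypothesis f4 : msize f = 4%N.
Hypothesis r0 : r != 0.
Hypothesis cmc_f : r ^+ 2 *: norm2_grad f ^+ 3 - cmc_numerator f ^+ 2 = p * f.

Lemma cmc_jet3_singular v u : jet3 f v v v = 0 -> jet3 f u v v = 0.
Proof.
move=> vvv; rewrite /jet3 meval_dderivE big1 // => i _.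
rewrite -dderiv_delta dderivC (dderivC _ v) dderiv_delta.
rewrite (@cubic_part_singular _ _ f f4 (r ^+ 2) p v) ?mulr0 //.
by rewrite expf_eq0.
Qed.

Lemma cmc_cubic_part_neq0 : exists w, jet3 f w w w != 0.
Proof.
have [i [j [k h]]] := cubic_third_derivative_neq0 f4.
apply: (@trilinear_cube_neq0 _ _ (jet3 f) (@jet3_linear _ _ f)
  (@jet3_sym12 _ _ f) (@jet3_sym23 _ _ f) cmc_jet3_singular
  (delta_mx 0 k) (delta_mx 0 j) (delta_mx 0 i)).
by rewrite /jet3 !dderiv_delta.
Qed.

(** At a zero of [f] the right-hand side of the identity vanishes, which leaves the relation
    required by [gradient_le_hessian]. *)
Lemma cmc_gradient_bound : exists K, forall z M, ev f z = 0 ->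
  (forall i j, `|ev (f^`M(i)^`M(j)) z| <= M) ->
  forall u, `|ev (dderiv u f) z| <= (\sum_i `|u 0 i|) * (K * M).
Proof.
exists (4 * n%:R / `|r|) => z M fz hM u.
rewrite meval_dderivE; apply: le_trans (ler_norm_sum _ _ _) _.
rewrite mulr_suml; apply: ler_sum => i _; rewrite normrM ler_wpM2l //.
apply: (gradient_le_hessian (g := fun i => ev (f^`M(i)) z)
  (h := fun i j => ev (f^`M(i)^`M(j)) z) r0 hM).
have := congr1 (fun g => ev g z) cmc_f.
rewrite /= mevalM fz mulr0 mevalB mevalZ !rmorphXn /= => /eqP.
rewrite subr_eq0 => /eqP.
have -> : ev (norm2_grad f) z = \sum_i ev (f^`M(i)) z ^+ 2.
  by rewrite norm2_gradE raddf_sum; apply: eq_bigr => j _; rewrite /= rmorphXn.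
move=> ->; congr (_ ^+ 2); rewrite /cmc_numerator mevalB !mevalM.
have -> : ev (norm2_grad f) z = \sum_i ev (f^`M(i)) z ^+ 2.
  by rewrite norm2_gradE raddf_sum; apply: eq_bigr => j _; rewrite /= rmorphXn.
rewrite -mpolyC_nat mevalC /laplacian raddf_sum; congr (_ - _).
rewrite dotvE raddf_sum; apply: eq_bigr => j _; rewrite /= !mxE mevalM.
rewrite mderiv_norm2_grad mevalM -mpolyC_nat mevalC; congr (_ * (_ * _)).
by rewrite raddf_sum; apply: eq_bigr => k _; rewrite /= mevalM.
Qed.

Variable w : 'rV[R]_n.
Hypothesis fw : jet3 f w w w != 0.

(** As [u] drops out of the third derivatives, the Hessian at [y *: w + s *: u] is bounded by a
    multiple of 1 + |y| uniformly in [s]; at zeros of [f] the gradient inherits this bound. *)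
Lemma cmc_ker_invariant u x :
  jet3 f u w w = 0 -> ev f (x *: w + u) = ev f (x *: w).
Proof.
move=> uw.
have Ku a b : jet3 f u a b = 0.
  exact: (trilinear_ker_eq0 (@jet3_linear _ _ f) (@jet3_sym12 _ _ f)
    (@jet3_sym23 _ _ f) cmc_jet3_singular fw).
have [K HK] := cmc_gradient_bound.
pose e (a : 'I_n) : 'rV[R]_n := delta_mx 0 a.
pose M0 := \sum_i \sum_j (`|jet2 f (e i) (e j)| + `|jet3 f w (e i) (e j)|).
have M00 : 0 <= M0 by do 2!(apply: sumr_ge0 => ? _); exact: addr_ge0.
have hess y s i j : `|ev (f^`M(i)^`M(j)) (y *: w + s *: u)| <= M0 * (1 + `|y|).
  rewrite -!dderiv_delta -/(e i) -/(e j) cubic_dderiv2_jetE // jet3_linear.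
  rewrite (linear_formZ (fun c a b => jet3_linear f c a b (e j) (e i))) Ku.
  rewrite mulr0 addr0.
  have t0 : `|jet2 f (e j) (e i)| + `|jet3 f w (e j) (e i)| <= M0.
    rewrite /M0 (bigD1 j) //= (bigD1 i) //= -addrA lerDl addr_ge0 //.
      by apply: sumr_ge0 => ? _; exact: addr_ge0.
    by do 2!(apply: sumr_ge0 => ? _); exact: addr_ge0.
  apply: le_trans (ler_normD _ _) _; rewrite normrM.
  apply: le_trans (ler_wpM2r _ t0); last exact: addr_ge0.
  move: (jet2 _ _ _) (jet3 _ _ _ _) => a b.
  by have := normr_ge0 y; have := normr_ge0 a; have := normr_ge0 b; nra.
pose S (v : 'rV[R]_n) := \sum_i `|v 0 i|.
have S0 v : 0 <= S v by apply: sumr_ge0.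
have bound y s v : S v <= S w + S u -> ev f (y *: w + s *: u) = 0 ->
   `|ev (dderiv v f) (y *: w + s *: u)|
     <= (S w + S u) * (`|K| * M0) * (1 + `|y|).
  move=> Sv fz; apply: le_trans (HK _ _ fz (hess y s) v) _.
  have KM : 0 <= M0 * (1 + `|y|) by rewrite mulr_ge0 ?addr_ge0.
  rewrite -!mulrA; apply: (@le_trans _ _ (S v * (`|K| * (M0 * (1 + `|y|))))).
    by apply: (ler_wpM2l (S0 v)); apply: (ler_wpM2r KM); exact: ler_norm.
  by apply: ler_wpM2r => //; exact: mulr_ge0.
rewrite (cubic_jetE f4 (_ + u)) (cubic_jetE f4 (x *: w)).
apply: (cubic_function_ker_invariant (@jet1_linear _ _ f) (@jet2_linear _ _ f)
  (@jet2C _ _ f) (@jet3_linear _ _ f) (@jet3_sym12 _ _ f) (@jet3_sym23 _ _ f)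
  fw Ku (K := (S w + S u) * (`|K| * M0))) => y s.
rewrite -(cubic_jetE f4) -!(cubic_dderiv_jetE f4) => fz.
by split; apply: bound; rewrite // ?lerDl ?lerDr.
Qed.

End CmcCubic.

(* [msize f] is the total degree plus one, so [msize f = 4] is degree three. *)
Theorem theorem1 (R : realType) (n : nat) (f : {mpoly R[n]})
    (deg_f : msize f = 4%N) (irr_f : irreducible_mpoly f) :
  ~ algebraic_cmc f.
Proof.
case=> H [p [H0 eqf]].
have [n1|n1] := eqVneq n 1%N.
  subst n.
  have [i [j [k]]] := cubic_third_derivative_neq0 deg_f.
  rewrite (ord1 i) (ord1 j) (ord1 k) -!dderiv_delta => C0.
  apply: (one_variable_reducible (c := fun=> 1) deg_f _ C0 _ irr_f).
    by rewrite big_ord1 mulr1 mxE.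
  by move=> z; apply: meval_eq => a; rewrite (ord1 a) big_ord1 !mxE !mulr1.
(* The square of [r] is the constant of the identity, nonzero since [n] is not 1. *)
pose r : R := 2 * (n%:R - 1) * H.
have r0 : r != 0.
  by rewrite !mulf_neq0 ?pnatr_eq0 // subr_eq0 pnatr_eq1.
have cmc_f : r ^+ 2 *: norm2_grad f ^+ 3 - cmc_numerator f ^+ 2 = p * f.
  by rewrite -eqf; congr (_ *: _ - _); rewrite /r; ring.
have [w Dw] := cmc_cubic_part_neq0 deg_f r0 cmc_f.
pose a := ev (dderiv w (dderiv w (dderiv w f))) 0.
(* The coefficients of the form l(z) = [jet3 f z w w / jet3 f w w w]. It is 1 at [w], and [z] minus
   l(z) times [w] lies in its kernel, where [cmc_ker_invariant] applies. *)
pose c i := ev ((dderiv w (dderiv w f))^`M(i)) 0 / a.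
have lE (z : 'rV[R]_n) : \sum_i z 0 i * c i =
    ev (dderiv z (dderiv w (dderiv w f))) 0 / a.
  by rewrite meval_dderivE mulr_suml; apply: eq_bigr => i _; rewrite mulrA.
apply: (one_variable_reducible deg_f _ Dw _ irr_f (c := c)).
  by rewrite lE divff.
move=> z; rewrite lE; set l := _ / a.
have {1}-> : z = l *: w + (- l *: w + z) by rewrite scaleNr addrA subrr add0r.
apply: (cmc_ker_invariant deg_f r0 cmc_f Dw).
by rewrite jet3_linear mulNr /l divfK // addNr.
Qed.
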